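(* Let $\mathrm{Sym}$ be a fixed set with at least two elements, and let $\mathrm{Dtry} := \mathrm{Maybe}\circ \mathfrak{m}_{\mathrm{Record}_{\neq\emptyset}} \colon \mathbf{Set}\to\mathbf{Set}$. Then $\mathrm{Dtry}$ is a polynomial monad.
   Context: For a set $A$, $y^A\colon\mathbf{Set}\to\mathbf{Set}$ is the functor $X\mapsto X^A$. A functor $p\colon\mathbf{Set}\to\mathbf{Set}$ is polynomial if there is a family of sets $(F_i)_{i\in p(1)}$ with $p\cong\sum_{i\in p(1)}y^{F_i}$. The category $\mathbf{Poly}$ has polynomial functors as objects and natural transformations as morphisms. A polynomial monad is a monad $(M,\eta,\mu)$ on $\mathbf{Set}$ whose underlying functor $M$ is polynomial; $\mathbf{PolyMon}$ is the full subcategory of the category of monads on $\mathbf{Set}$ on the polynomial monads. To say that a functor is a polynomial monad means that it is the underlying functor of a polynomial monad. The functor $\mathrm{Maybe}$ is $y+1$, i.e. $\mathrm{Maybe}(X)=X+1$. The functor $\mathrm{Record}_{\neq\emptyset}$ is the polynomial functor $\sum_{U} y^U$, where $U$ ranges over the nonempty finite subsets of $\mathrm{Sym}$ (thought of as a set of symbols, or names). The forgetful functor $\mathbf{PolyMon}\to\mathbf{Poly}$, $(m,\eta,\mu)\mapsto m$, has a left adjoint, denoted $p\mapsto\mathfrak{m}_p$; $\mathfrak{m}_p$ is called the free monad on $p$. In the composite defining $\mathrm{Dtry}$, $\mathfrak{m}_{\mathrm{Record}_{\neq\emptyset}}$ denotes the underlying functor of the free monad on $\mathrm{Record}_{\neq\emptyset}$.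 Concretely, $\mathfrak{m}_{\mathrm{Record}_{\neq\emptyset}}(X)$ is the set inductively generated by elements $\mathrm{Pure}(x)$ for $x\in X$ and $\mathrm{Join}(r)$ for $r\in\mathrm{Record}_{\neq\emptyset}(\mathfrak{m}_{\mathrm{Record}_{\neq\emptyset}}(X))$. *)

(* Defs.v *)
From mathcomp Require Import all_boot.
From mathcomp Require Import boolp classical_sets cardinality.

Set Implicit Arguments.
Unset Strict Implicit.
Unset Printing Implicit Defensive.

Local Open Scope classical_set_scope.

(** [SET] fixes one universe, playing the role of the category of sets, so that
    all functors below are endofunctors of the same category. *)
Definition SET := Type.

Record functor := Functor {
  fobj :> SET -> SET;
  fmap : forall X Y : SET, (X -> Y) -> fobj X -> fobj Y;
  fmap_id : forall X : SET, fmap (@id X) = id;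
  fmap_comp : forall (X Y Z : SET) (g : Y -> Z) (f : X -> Y),
    fmap (g \o f) = fmap g \o fmap f }.

Arguments fmap F {X Y} f : rename.

Record nattrans (F G : functor) := NatTrans {
  ntapp :> forall X : SET, F X -> G X;
  natural : forall (X Y : SET) (f : X -> Y),
    @ntapp Y \o fmap F f = fmap G f \o @ntapp X }.

Arguments ntapp {F G} n X : rename.

Definition natiso (F G : functor) : Prop :=
  exists (a : nattrans F G) (b : nattrans G F),
    forall X : SET, cancel (a X) (b X) /\ cancel (b X) (a X).

Definition idF : functor :=
  @Functor (fun X => X) (fun X Y f => f)
    (fun X => erefl) (fun X Y Z g f => erefl).

Section Composition.
Variables G F : functor.

Let compF_map (X Y : SET) (f : X -> Y) : G (F X) -> G (F Y) :=
  fmap G (fmap F f).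

Fact compF_id (X : SET) : compF_map (@id X) = id.
Proof. by rewrite /compF_map !fmap_id. Qed.

Fact compF_comp (X Y Z : SET) (g : Y -> Z) (f : X -> Y) :
  compF_map (g \o f) = compF_map g \o compF_map f.
Proof. by rewrite /compF_map fmap_comp fmap_comp. Qed.

Definition compF : functor :=
  @Functor (fun X => G (F X)) compF_map compF_id compF_comp.
End Composition.

Record family := Family { shape : SET; arity : shape -> SET }.

(** The functor [\sum_(i : shape B) y^(arity i)]. *)
Section Polynomial.
Variable B : family.

Definition poly_obj (X : SET) : SET := {i : shape B & arity i -> X}.

Definition poly_map (X Y : SET) (f : X -> Y) (t : poly_obj X) : poly_obj Y :=
  existT _ (projT1 t) (f \o projT2 t).

Fact poly_id (X : SET) : poly_map (@id X) = id.
Proof. by apply: funext => -[i k]. Qed.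

Fact poly_comp (X Y Z : SET) (g : Y -> Z) (f : X -> Y) :
  poly_map (g \o f) = poly_map g \o poly_map f.
Proof. by []. Qed.

Definition poly : functor := @Functor poly_obj poly_map poly_id poly_comp.
End Polynomial.

Coercion poly : family >-> functor.

Definition is_polynomial (p : functor) : Prop :=
  exists F : p unit -> SET, natiso p (poly (Family F)).

Record monad := Monad {
  underlying :> functor;
  eta : nattrans idF underlying;
  mu : nattrans (compF underlying underlying) underlying;
  mu_etal : forall X : SET, mu X \o eta (underlying X) = id;
  mu_etar : forall X : SET, mu X \o fmap underlying (eta X) = id;
  mu_assoc : forall X : SET,
    mu X \o mu (underlying X) = mu X \o fmap underlying (mu X) }.

Record polynomial_monad := PolynomialMonad {
  pm_monad :> monad;
  pm_polynomial : is_polynomial pm_monad }.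

Definition is_polynomial_monad (F : functor) : Prop :=
  exists M : polynomial_monad, underlying M = F.

(** The free monad on [poly B]; its universal property is [freeM_universal]. *)
Section Free.
Variable B : family.

Inductive free_obj (X : SET) : SET :=
  | Pure of X
  | Join of poly B (free_obj X).

(* The automatically generated principle gives no induction hypothesis for the
   occurrences of [free_obj X] nested inside [poly B]. *)
Lemma free_obj_rect' (X : SET) (P : free_obj X -> Type) :
  (forall x, P (Pure x)) ->
  (forall (i : shape B) (k : arity i -> free_obj X),
     (forall b, P (k b)) -> P (Join (existT _ i k))) ->
  forall t, P t.
Proof.
move=> HP HJ; fix IH 1 => -[x|[i k]]; first exact: HP.
by apply: HJ => b; apply: IH.
Defined.

Fixpoint free_bind (X Y : SET) (f : X -> free_obj Y) (t : free_obj X) :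
    free_obj Y :=
  match t with
  | Pure x => f x
  | Join (existT i k) => Join (existT _ i (fun b => free_bind f (k b)))
  end.

Definition free_map (X Y : SET) (f : X -> Y) : free_obj X -> free_obj Y :=
  free_bind (fun x => Pure (f x)).

Lemma free_bind_pure (X : SET) (t : free_obj X) : free_bind (@Pure X) t = t.
Proof.
elim/free_obj_rect': t => // i k IH /=.
by congr (Join (existT _ i _)); apply: funext.
Qed.

Lemma free_bindA (X Y Z : SET) (g : Y -> free_obj Z) (f : X -> free_obj Y) t :
  free_bind g (free_bind f t) = free_bind (fun x => free_bind g (f x)) t.
Proof.
elim/free_obj_rect': t => // i k IH /=.
by congr (Join (existT _ i _)); apply: funext.
Qed.

Fact free_map_id (X : SET) : free_map (@id X) = id.
Proof. by apply: funext => t; apply: free_bind_pure. Qed.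

Fact free_map_comp (X Y Z : SET) (g : Y -> Z) (f : X -> Y) :
  free_map (g \o f) = free_map g \o free_map f.
Proof. by apply: funext => t; rewrite /free_map /= free_bindA. Qed.

Definition free : functor :=
  @Functor free_obj free_map free_map_id free_map_comp.

Definition free_eta : nattrans idF free :=
  @NatTrans idF free (@Pure) (fun X Y f => erefl).

Fact free_mu_natural (X Y : SET) (f : X -> Y) :
  free_bind id \o fmap (compF free free) f = fmap free f \o free_bind id.
Proof. by apply: funext => t /=; rewrite /free_map !free_bindA. Qed.

Definition free_mu : nattrans (compF free free) free :=
  @NatTrans (compF free free) free (fun X => free_bind id) free_mu_natural.

Fact free_mu_etal (X : SET) : free_mu X \o free_eta (free X) = id.
Proof. by []. Qed.

Fact free_mu_etar (X : SET) : free_mu X \o fmap free (free_eta X) = id.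
Proof.
by apply: funext => t /=; rewrite /free_map free_bindA; apply: free_bind_pure.
Qed.

Fact free_mu_assoc (X : SET) :
  free_mu X \o free_mu (free X) = free_mu X \o fmap free (free_mu X).
Proof. by apply: funext => t /=; rewrite /free_map !free_bindA. Qed.

Definition freeM : monad :=
  @Monad free free_eta free_mu free_mu_etal free_mu_etar free_mu_assoc.

Definition free_unit_app (X : SET) (r : poly B X) : free X :=
  Join (fmap (poly B) (@Pure X) r).

Fact free_unit_natural (X Y : SET) (f : X -> Y) :
  @free_unit_app Y \o fmap (poly B) f = fmap free f \o @free_unit_app X.
Proof. by apply: funext => -[i k]. Qed.

Definition free_unit : nattrans (poly B) free :=
  @NatTrans (poly B) free free_unit_app free_unit_natural.
End Free.

Definition monad_morphism (M N : monad) (a : nattrans M N) : Prop :=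
  forall X : SET,
    a X \o eta M X = eta N X /\
    a X \o mu M X = mu N X \o fmap N (a X) \o a (M X).

Theorem freeM_universal (B : family) (N : monad)
    (a : nattrans (poly B) N) :
  exists phi : nattrans (freeM B) N,
    [/\ monad_morphism phi,
        forall X : SET, phi X \o free_unit B X = a X &
        forall psi : nattrans (freeM B) N, monad_morphism psi ->
          (forall X : SET, psi X \o free_unit B X = a X) ->
          forall X : SET, psi X = phi X].
Proof.
pose ev := fix ev (X : SET) (t : free B X) : N X :=
  match t with
  | Pure x => eta N X x
  | Join (existT i k) => mu N X (a (N X) (existT _ i (fun b => ev X (k b))))
  end.
have evJ X (i : shape B) (k : arity i -> free B X) : ev X (Join (existT _ i k)) =
    mu N X (a (N X) (existT _ i (ev X \o k))) by [].
have aE (X Y : SET) (f : X -> Y) (i : shape B) (k : arity i -> X) :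
    a Y (existT _ i (f \o k)) = fmap N f (a X (existT _ i k)).
  exact: (congr1 (@^~ (existT _ i k)) (natural a f)).
have muE (X Y : SET) (f : X -> Y) t :
    mu N Y (fmap N (fmap N f) t) = fmap N f (mu N X t).
  exact: (congr1 (@^~ t) (natural (mu N) f)).
have etaE (X Y : SET) (f : X -> Y) x : eta N Y (f x) = fmap N f (eta N X x).
  exact: (congr1 (@^~ x) (natural (eta N) f)).
have muL (X : SET) t : mu N X (eta N (N X) t) = t.
  exact: (congr1 (@^~ t) (mu_etal N X)).
have muR (X : SET) t : mu N X (fmap N (eta N X) t) = t.
  exact: (congr1 (@^~ t) (mu_etar N X)).
have muA (X : SET) t : mu N X (mu N (N X) t) = mu N X (fmap N (mu N X) t).
  exact: (congr1 (@^~ t) (mu_assoc N X)).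
have evN (X Y : SET) (f : X -> Y) : ev Y \o fmap (free B) f = fmap N f \o ev X.
  apply: funext => t /=; elim/free_obj_rect': t => [x|i k IH].
    exact: etaE.
  rewrite evJ -muE -aE /=; congr (mu N Y (a _ (existT _ i _))).
  by apply: funext => b; apply: IH.
pose phi := @NatTrans (freeM B) N ev evN.
exists phi; split.
- move=> X; split; first by [].
  apply: funext => t /=; elim/free_obj_rect': t => [x|i k IH].
    by rewrite -[RHS]/(mu N X (fmap N (ev X) (eta N _ x))) -etaE muL.
  rewrite evJ -muE muA -!aE; congr (mu N X (a _ (existT _ i _))).
  by apply: funext => b; apply: IH.
- move=> X; apply: funext => -[i k] /=.
  by rewrite (aE _ _ (eta N X)) muR.
- move=> psi psiM psiU X; apply: funext => t.
  elim/free_obj_rect': t => [x|i k IH].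
    exact: (congr1 (@^~ x) (psiM X).1).
  have /= E := congr1 (@^~ (free_unit B _ (existT _ i k))) (psiM X).2.
  have /= U := congr1 (@^~ (existT _ i k)) (psiU (free B X)).
  rewrite -[LHS]/(psi X (free_bind id (free_unit B _ (existT _ i k)))).
  rewrite [LHS]E U.
  rewrite -aE; congr (mu N X (a _ (existT _ i _))).
  by apply: funext => b; apply: IH.
Qed.

Fact Maybe_id (X : SET) : omap (@id X) = id.
Proof. by apply: funext => -[]. Qed.

Fact Maybe_comp (X Y Z : SET) (g : Y -> Z) (f : X -> Y) :
  omap (g \o f) = omap g \o omap f.
Proof. by apply: funext => -[]. Qed.

Definition Maybe : functor :=
  @Functor option (fun X Y f => omap f) Maybe_id Maybe_comp.

Definition nonempty_finite_subset (Sym : SET) : SET :=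
  {U : set Sym | finite_set U /\ U !=set0}.

Definition subset_elements (Sym : SET) (U : nonempty_finite_subset Sym) : SET :=
  set_type (sval U).

Definition RecordNE (Sym : SET) : family := Family (@subset_elements Sym).

Definition Dtry (Sym : SET) : functor := compF Maybe (free (RecordNE Sym)).

(* Main.v *)
From mathcomp Require Import all_boot.
From mathcomp Require Import boolp classical_sets cardinality.
Require Import Defs.

Set Implicit Arguments.
Unset Strict Implicit.
Unset Printing Implicit Defensive.

Local Open Scope classical_set_scope.

(** A record is the same as a partial function on [Sym] with nonempty finite
    support. Substituting possibly undefined trees for the leaves of a tree,
    and erasing bottom-up every record whose support has become empty, is a
    Kleisli extension for [Dtry]. Its associativity holds because, on partial
    functions, substitution acts entrywise. The functor [Dtry] is polynomial
    because a tree is determined by its shape, a tree with leaves in [unit],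
    together with a labelling of the leaves of that shape. *)

(** * Records as finitely supported partial functions *)

Definition support (S A : Type) (h : S -> option A) : set S :=
  [set s | isSome (h s)].

Definition some_value (A : Type) (o : option A) : isSome o -> A :=
  match o with
  | Some a => fun=> a
  | None => fun no => match notF no with end
  end.

Lemma some_valueE (A : Type) (o : option A) (oS : isSome o) :
  Some (some_value oS) = o.
Proof. by case: o oS. Qed.

Definition record (Sym A : SET) (U : shape (RecordNE Sym)) (k : arity U -> A) :
    RecordNE Sym A := existT _ U k.

(** [None] plays the role of the empty record, so that the nowhere defined function is covered
    too. *)
Definition entries (Sym A : SET) (r : option (RecordNE Sym A)) (s : Sym) :
    option A :=
  match r with
  | Some (existT U k) => omap k (insub s : option (set_type (sval U)))
  | None => None
  end.

(* Also [None] when the support of [h] is infinite. *)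
Definition record_of (Sym A : SET) (h : Sym -> option A) :
    option (RecordNE Sym A) :=
  match pselect (finite_set (support h) /\ support h !=set0) with
  | left supp_h => Some (@record Sym A (exist _ (support h) supp_h)
      (fun u : set_type (support h) => some_value (set_valP u)))
  | right _ => None
  end.

Lemma support_entries (Sym A : SET) (U : shape (RecordNE Sym))
    (k : arity U -> A) : support (entries (Some (record k))) = sval U.
Proof.
apply/seteqP; split => s; rewrite /support /=.
  by case: insubP => //= u sU _ _; apply: set_mem.
by move=> Us; case: insubP => //=; rewrite mem_set.
Qed.

Lemma finite_support_entries (Sym A : SET) (r : option (RecordNE Sym A)) :
  finite_set (support (entries r)).
Proof.
case: r => [[U k]|]; first by rewrite support_entries; case: (svalP U).
by rewrite (_ : support _ = set0) //; apply/seteqP; split.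
Qed.

(** The support recovers the index set, whose nonemptiness separates a record from [None]; the
    values then recover the fields. *)
Lemma entries_inj (Sym A : SET) : injective (@entries Sym A).
Proof.
have SomeN U (k : arity U -> A) :
    entries (Some (record k)) <> entries (None : option (RecordNE Sym A)).
  move=> /(congr1 (@support _ _)); rewrite support_entries.
  by case: (svalP U) => _ [s Us] E; move: Us; rewrite E.
move=> [[U k]|] [[U' k']|] // E; [|by case: (SomeN _ _ E)|by case: (SomeN U' k')].
have UU' : U = U'.
  apply: eq_sig_hprop => [V p q|]; first exact: Prop_irrelevance.
  have := congr1 (@support _ _) E.
  by rewrite !support_entries.
case: _ / UU' k' E => k' E; congr (Some (existT _ U _)).
by apply: funext => u; have := congr1 (@^~ (val u)) E; rewrite /= valK => -[].
Qed.

Lemma record_ofK (Sym A : SET) (h : Sym -> option A) :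
  finite_set (support h) -> entries (record_of h) = h.
Proof.
move=> finh; apply: funext => s; rewrite /record_of; case: pselect => [p|np] /=.
  case: insubP => [u _ <- /=|]; first exact: some_valueE.
  by move=> /negP hs; case E: (h s) => //; case: hs; rewrite mem_set // /support /= E.
(* As the support is finite, it can only fail the test by being empty, so a defined value at [s] is
   absurd. *)
by case E: (h s) => //; case: np; split=> //; exists s; rewrite /support /= E.
Qed.

Lemma entriesK (Sym A : SET) (r : option (RecordNE Sym A)) :
  record_of (entries r) = r.
Proof. by apply: entries_inj; rewrite record_ofK //; apply: finite_support_entries. Qed.

(** * Substitution with pruning, and the monad laws *)

Fixpoint prune_bind (Sym X Y : SET) (f : X -> Dtry Sym Y)
    (t : free (RecordNE Sym) X) : Dtry Sym Y :=
  match t with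
  | Pure x => f x
  | Join (existT U k) =>
      omap (@Join _ _) (record_of (fun s =>
        obind (fun u => prune_bind f (k u))
              (insub s : option (set_type (sval U)))))
  end.

(** No field is erased, so by [entriesK] each record is rebuilt on its original index set. The right
    unit law and the description of the functor action rest on this. *)
Lemma prune_bind_total (Sym X Y : SET) (f : X -> free (RecordNE Sym) Y) t :
  prune_bind (fun x => Some (f x)) t = Some (free_bind f t).
Proof.
elim/free_obj_rect': t => //= U k IH.
rewrite -[RHS]/(omap (@Join _ Y) (Some (record (fun u => free_bind f (k u))))).
rewrite -[X in _ = omap _ X]entriesK; congr (omap _ (record_of _)).
by apply: funext => s /=; case: insub => //= u; rewrite IH.
Qed.

(** Treats surviving and erased records uniformly: for [r = None] the right side prunes the nowhere
    defined function, which again gives [None]. *)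
Lemma prune_bind_Join (Sym X Y : SET) (f : X -> Dtry Sym Y)
    (r : option (RecordNE Sym (free (RecordNE Sym) X))) :
  obind (prune_bind f) (omap (@Join _ _) r) =
  omap (@Join _ _) (record_of (fun s => obind (prune_bind f) (entries r s))).
Proof.
case: r => [[U k]|] /=; last by rewrite -[fun=> None]/(entries None) entriesK.
by congr (omap _ (record_of _)); apply: funext => s; case: insub.
Qed.

(** Reading off entries cancels the inner [record_of], so both sides apply [record_of] to functions
    that can be compared at each symbol by induction. *)
Lemma prune_bindA (Sym X Y Z : SET) (g : Y -> Dtry Sym Z) (f : X -> Dtry Sym Y) t :
  obind (prune_bind g) (prune_bind f t) =
  prune_bind (fun x => obind (prune_bind g) (f x)) t.
Proof.
elim/free_obj_rect': t => // U k IH.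
rewrite [prune_bind f _]/= prune_bind_Join record_ofK /=.
  congr (omap _ (record_of _)); apply: funext => s.
  by case: insub => //= u; rewrite IH.
(* The fields that survive [f] lie in [U], which gives the finiteness required by [record_ofK]. *)
apply: sub_finite_set (svalP U).1 => s; rewrite /support /=.
by case: insubP => //= u sU _ _; apply: set_mem.
Qed.

Definition dtry_bind (Sym X Y : SET) (f : X -> Dtry Sym Y) :
    Dtry Sym X -> Dtry Sym Y :=
  obind (prune_bind f).

Definition dtry_pure (Sym X : SET) (x : X) : Dtry Sym X := Some (Pure _ x).

Lemma dtry_bindA (Sym X Y Z : SET) (g : Y -> Dtry Sym Z) (f : X -> Dtry Sym Y) t :
  dtry_bind g (dtry_bind f t) = dtry_bind (fun x => dtry_bind g (f x)) t.
Proof. by case: t => //= t; apply: prune_bindA. Qed.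

Lemma dtry_bind_pure (Sym X : SET) (t : Dtry Sym X) :
  dtry_bind (@dtry_pure Sym X) t = t.
Proof. by case: t => //= t; rewrite prune_bind_total free_bind_pure. Qed.

(** With the functor action in Kleisli form, naturality and the laws involving [fmap] follow from
    [dtry_bindA]. *)
Lemma dtry_mapE (Sym X Y : SET) (f : X -> Y) :
  fmap (Dtry Sym) f = dtry_bind (fun x => dtry_pure Sym (f x)).
Proof. by apply: funext => -[t|] //=; rewrite prune_bind_total. Qed.

Definition dtry_eta (Sym : SET) : nattrans idF (Dtry Sym) :=
  @NatTrans idF (Dtry Sym) (@dtry_pure Sym) (fun X Y f => erefl).

Lemma dtry_mu_natural (Sym X Y : SET) (f : X -> Y) :
  dtry_bind id \o fmap (compF (Dtry Sym) (Dtry Sym)) f =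
  fmap (Dtry Sym) f \o dtry_bind id.
Proof.
apply: funext => t; rewrite -[fmap (compF _ _) f]/(fmap (Dtry Sym) (fmap _ f)).
by rewrite !dtry_mapE /= !dtry_bindA.
Qed.

Definition dtry_mu (Sym : SET) : nattrans (compF (Dtry Sym) (Dtry Sym)) (Dtry Sym) :=
  @NatTrans (compF (Dtry Sym) (Dtry Sym)) (Dtry Sym)
    (fun X => dtry_bind id) (@dtry_mu_natural Sym).

Lemma dtry_mu_etal (Sym X : SET) : dtry_mu Sym X \o dtry_eta Sym (Dtry Sym X) = id.
Proof. by []. Qed.

Lemma dtry_mu_etar (Sym X : SET) :
  dtry_mu Sym X \o fmap (Dtry Sym) (dtry_eta Sym X) = id.
Proof.
apply: funext => t; rewrite dtry_mapE /= dtry_bindA; exact: dtry_bind_pure.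
Qed.

Lemma dtry_mu_assoc (Sym X : SET) :
  dtry_mu Sym X \o dtry_mu Sym (Dtry Sym X) =
  dtry_mu Sym X \o fmap (Dtry Sym) (dtry_mu Sym X).
Proof. by apply: funext => t; rewrite dtry_mapE /= !dtry_bindA. Qed.

Definition dtry_monad (Sym : SET) : monad :=
  Monad (@dtry_mu_etal Sym) (@dtry_mu_etar Sym) (@dtry_mu_assoc Sym).

(** * Trees as shapes with labelled leaves, and polynomiality *)

Fixpoint leaves (B : family) (X : SET) (t : free_obj B X) : SET :=
  match t with
  | Pure _ => unit
  | Join (existT i k) => {b : arity i & leaves (k b)}
  end.

Definition labelled (B : family) : functor := poly (Family (@leaves B unit)).

Definition labelled_join (B : family) (X : SET) (i : shape B)
    (q : arity i -> labelled B X) : labelled B X :=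
  existT (fun s => leaves s -> X) (Join (existT _ i (fun b => projT1 (q b))))
    (fun u : {b : arity i & leaves (projT1 (q b))} =>
       projT2 (q (projT1 u)) (projT2 u)).

Fixpoint split_labels (B : family) (X : SET) (t : free B X) : labelled B X :=
  match t with
  | Pure x => existT (fun s => leaves s -> X) (Pure B tt) (fun=> x)
  | Join (existT i k) => labelled_join (fun b => split_labels (k b))
  end.

(** The labelling is taken after the match because its type depends on the shape; each branch
    receives its restriction to the leaves below. *)
Fixpoint fill (B : family) (X : SET) (s : free_obj B unit) :
    (leaves s -> X) -> free B X :=
  match s return (leaves s -> X) -> free B X with
  | Pure _ => fun l => Pure B (l tt)
  | Join (existT i k) => fun l =>
      Join (existT _ i (fun b => fill (fun u => l (existT (fun b => leaves (k b)) b u))))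
  end.

Lemma split_labels_natural (B : family) (X Y : SET) (f : X -> Y) (t : free B X) :
  split_labels (fmap (free B) f t) = fmap (labelled B) f (split_labels t).
Proof.
elim/free_obj_rect': t => // i k IH /=.
rewrite (_ : (fun b => _) = fun b => fmap (labelled B) f (split_labels (k b))) //.
by apply: funext => b; apply: IH.
Qed.

Lemma fill_natural (B : family) (X Y : SET) (f : X -> Y) (s : free B unit)
    (l : leaves s -> X) :
  fill (f \o l) = fmap (free B) f (fill l).
Proof.
elim/free_obj_rect': s l => //= i k IH l.
by congr (Join (existT _ i _)); apply: funext => b; apply: IH.
Qed.

Lemma split_labelsK (B : family) (X : SET) (t : free B X) :
  fill (projT2 (split_labels t)) = t.
Proof.
elim/free_obj_rect': t => //= i k IH.
by congr (Join (existT _ i _)); apply: funext => b; apply: IH.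
Qed.

Lemma fillK (B : family) (X : SET) (s : free B unit) (l : leaves s -> X) :
  split_labels (fill l) = existT _ s l.
Proof.
elim/free_obj_rect': s l => [[] l|i k IH l] /=.
  by congr existT; apply: funext => -[].
(* Shape and labelling of each branch are replaced together as one dependent pair, which avoids
   transporting labels along equalities of shapes. *)
rewrite (_ : (fun b => _) = fun b => existT (fun s => leaves s -> X) (k b)
    (fun u => l (existT (fun b => leaves (k b)) b u))); last by apply: funext => b; apply: IH.
by rewrite /labelled_join /=; congr existT; apply: funext => -[].
Qed.

(** The point added by [Maybe] is the summand [y^0], whence [void]. *)
Definition dtry_leaves (Sym : SET) (s : Dtry Sym unit) : SET :=
  if s is Some s' then leaves s' else void.

Definition dtry_split (Sym X : SET) (t : Dtry Sym X) :
    poly (Family (@dtry_leaves Sym)) X :=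
  if t is Some t' then
    existT (fun s => dtry_leaves s -> X) (Some (projT1 (split_labels t')))
      (projT2 (split_labels t'))
  else existT (fun s => dtry_leaves s -> X) None (of_void X).

Definition dtry_fill (Sym X : SET) (t : poly (Family (@dtry_leaves Sym)) X) :
    Dtry Sym X :=
  let: existT s l := t in
  match s return (dtry_leaves s -> X) -> Dtry Sym X with
  | Some s' => fun l => Some (fill l)
  | None => fun=> None
  end l.

Lemma dtry_split_natural (Sym X Y : SET) (f : X -> Y) :
  @dtry_split Sym Y \o fmap (Dtry Sym) f =
  fmap (poly (Family (@dtry_leaves Sym))) f \o @dtry_split Sym X.
Proof.
apply: funext => -[t|] /=; first by rewrite split_labels_natural.
by rewrite /poly_map /=; congr existT; apply: funext => -[].
Qed.

Lemma dtry_fill_natural (Sym X Y : SET) (f : X -> Y) :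
  @dtry_fill Sym Y \o fmap (poly (Family (@dtry_leaves Sym))) f =
  fmap (Dtry Sym) f \o @dtry_fill Sym X.
Proof. by apply: funext => -[[s|] l] //=; rewrite fill_natural. Qed.

Lemma dtry_splitK (Sym X : SET) : cancel (@dtry_split Sym X) (@dtry_fill Sym X).
Proof. by case=> [t|] //=; rewrite split_labelsK. Qed.

Lemma dtry_fillK (Sym X : SET) : cancel (@dtry_fill Sym X) (@dtry_split Sym X).
Proof.
case=> -[s|] l /=; first by rewrite fillK.
by congr existT; apply: funext => -[].
Qed.

Lemma dtry_polynomial (Sym : SET) : is_polynomial (Dtry Sym).
Proof.
exists (@dtry_leaves Sym), (NatTrans (@dtry_split_natural Sym)).
exists (NatTrans (@dtry_fill_natural Sym)) => X.
by split; [apply: dtry_splitK | apply: dtry_fillK].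
Qed.

Theorem proposition2p11 (Sym : SET) (Sym_ge2 : exists a b : Sym, a <> b) :
  is_polynomial_monad (Dtry Sym).
Proof. by exists (@PolynomialMonad (dtry_monad Sym) (dtry_polynomial Sym)). Qed.
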